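(* Let $R$ be a Prüfer domain, let $I$ be an ideal of $R$, and let $B$ be a content $R$-algebra. Then $\omega_B(IB)=\omega_R(I)$.
   Context: All rings are commutative with identity $1\neq 0$, and algebras are commutative with identity. Content algebras. Let $R$ be a ring and $B$ an $R$-algebra. For $f\in B$, the content of $f$ is the ideal $c(f)=\bigcap\{J : J \text{ is an ideal of } R \text{ and } f\in JB\}$ of $R$. The $R$-algebra $B$ is called a content $R$-algebra if: (1) $f\in c(f)B$ for all $f\in B$; (2) $c(rf)=r\,c(f)$ for all $r\in R$, $f\in B$, and $c(1_B)=R$; (3) for all $f,g\in B$ there exists an integer $n\geq 1$ such that $c(f)^n c(g)=c(f)^{n-1}c(fg)$ (with the convention that the zeroth power of an ideal is $R$). $n$-absorbing ideals. For a positive integer $n$, a proper ideal $I$ of a ring $R$ is an $n$-absorbing ideal of $R$ if whenever $x_1\cdots x_{n+1}\in I$ for $x_1,\ldots,x_{n+1}\in R$, then there are $n$ of the $x_i$'s whose product is in $I$. For a proper ideal $I$ of $R$, $\omega_R(I)=\min\{n\geq 1 : I \text{ is an } n\text{-absorbing ideal of } R\}$, with $\omega_R(I)=\infty$ if $I$ is not $n$-absorbing for any positive integer $n$; moreover $\omega_R(R)=0$. *)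

(* Defs.v *)
From HB Require Import structures.
From mathcomp Require Import all_boot all_order all_algebra.
From mathcomp Require Import all_classical.

Set Implicit Arguments.
Unset Strict Implicit.
Unset Printing Implicit Defensive.

Import GRing.Theory.
Local Open Scope ring_scope.
Local Open Scope classical_set_scope.

Section Ideals.
Context {A : comNzRingType}.

(* Not MathComp's [idealr_closed], which excludes the unit ideal. *)
Definition is_ideal (I : set A) : Prop :=
  [/\ I 0,
      forall x y, I x -> I y -> I (x + y) &
      forall a x, I x -> I (a * x)].

Definition ideal_gen (X : set A) : set A := smallest is_ideal X.

Definition ideal_mul (I J : set A) : set A :=
  ideal_gen [set x * y | x in I & y in J].

Definition ideal_exp (I : set A) (n : nat) : set A :=
  iter n (ideal_mul I) setT.

Definition absorbing (n : nat) (I : set A) : Prop :=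
  [/\ (0 < n)%N, is_ideal I, I != setT &
      forall x : 'I_n.+1 -> A, I (\prod_i x i) ->
        exists k, I (\prod_(i | i != k) x i)].

(* Extended naturals: [None] stands for infinity. *)
Definition omega (I : set A) : option nat :=
  if `[< I = setT >] then Some 0%N
  else if pselect (exists n, `[< absorbing n I >]) is left ex
  then Some (ex_minn ex)
  else None.

End Ideals.

Section Content.
Context {R : comNzRingType} {B : comAlgType R}.

(* The extended ideal J B, along the structure map r |-> r%:A. *)
Definition extension (J : set R) : set B :=
  ideal_gen [set r%:A | r in J].

Definition content (f : B) : set R :=
  \bigcap_(J in [set J : set R | is_ideal J /\ extension J f]) J.

End Content.
Arguments extension {R} B J.

Definition content_algebra (R : comNzRingType) (B : comAlgType R) : Prop :=
  [/\ forall f : B, extension B (content f) f,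
      forall (r : R) (f : B), content (r *: f) = [set r * a | a in content f],
      content (1 : B) = setT &
      forall f g : B, exists2 n : nat, (0 < n)%N &
        ideal_mul (ideal_exp (content f) n) (content g) =
        ideal_mul (ideal_exp (content f) n.-1) (content (f * g))].

Section Pruefer.
Context {R : idomainType}.

Definition is_fracmod (M : set {fraction R}) : Prop :=
  [/\ M 0,
      forall x y, M x -> M y -> M (x + y) &
      forall (a : R) x, M x -> M (tofrac a * x)].

Definition fractional_ideal (M : set {fraction R}) : Prop :=
  is_fracmod M /\
  exists2 d : R, d != 0 &
    forall x, M x -> exists a : R, tofrac d * x = tofrac a.

Definition fracmod_mul (M N : set {fraction R}) : set {fraction R} :=
  smallest is_fracmod [set x * y | x in M & y in N].

Definition invertible_ideal (I : set R) : Prop :=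
  exists2 M : set {fraction R}, fractional_ideal M &
    fracmod_mul [set tofrac a | a in I] M = range (@tofrac R).

End Pruefer.

Definition pruefer_domain (R : idomainType) : Prop :=
  forall s : seq R,
    ideal_gen [set` s] != [set 0] -> invertible_ideal (ideal_gen [set` s]).

(* Main.v *)
Require Import Defs.
From HB Require Import structures.
From mathcomp Require Import all_boot all_order all_algebra.
From mathcomp Require Import all_classical.
From mathcomp Require Import ring.

Set Implicit Arguments.
Unset Strict Implicit.
Unset Printing Implicit Defensive.

Import GRing.Theory.
Local Open Scope ring_scope.
Local Open Scope classical_set_scope.

(** Let [f_0 * ... * f_n] lie in [I B] while, for every [k], the product of the
    [f_i] with [i != k] does not.  The scalars carrying the latter product into
    [I B] form a proper ideal, contained in a maximal ideal [M_k].  Contents are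
    finitely generated, hence locally principal over a Pruefer domain, and a
    single [x_i] in [c(f_i)] can be chosen to generate [c(f_i)] locally at all
    of the finitely many [M_k].  Locally principal contents are also
    cancellative, so [c(f) c(g)] is contained in [c(fg)] and [x_0 * ... * x_n]
    lies in [I].  If [I] is [n]-absorbing then some [x_k] can be omitted;
    as the other [x_i] generate [c(f_i)] at [M_k], a scalar outside [M_k]
    carries the product of the [f_i], [i != k], into [I B], a contradiction. *)

(** * Ideal arithmetic, maximal ideals and Zorn's lemma *)

Section IdealTheory.
Variable A : comNzRingType.
Implicit Types (I K M X Y : set A).

Lemma ideal_gen_is_ideal X : is_ideal (ideal_gen X).
Proof.
split=> [J [[]]//|x y gx gy J [JI XJ]|a x gx J [JI XJ]].
- by case: (JI) => _ JD _; apply: JD; [apply: gx|apply: gy].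
- by case: (JI) => _ _ JM; apply: JM; apply: gx.
Qed.

Lemma ideal_genS X Y :
  X `<=` Y -> ideal_gen X `<=` ideal_gen Y.
Proof. exact: (sub_smallest2r (ideal_gen_is_ideal Y)). Qed.

Lemma ideal_unit I : is_ideal I -> I 1 -> I = setT.
Proof.
by move=> [_ _ IM] I1; apply/seteqP; split=> // x _; rewrite -[x]mulr1; apply: IM.
Qed.

(** Reduces an inclusion of [c K] in [x I] to a check on generators of [K]. *)
Lemma scaled_is_ideal I (c x : A) : is_ideal I ->
  is_ideal [set u | exists2 z, I z & c * u = x * z].
Proof.
move=> [I0 ID IM]; split=> [|u v [z Iz cu] [w Iw cv]|a u [z Iz cu]].
- by exists 0 => //; rewrite !mulr0.
- by exists (z + w); [apply: ID|rewrite !mulrDr cu cv].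
- by exists (a * z); [apply: IM|rewrite mulrCA cu mulrCA].
Qed.

Lemma ideal_expX K x n : K x -> ideal_exp K n (x ^+ n).
Proof.
move=> Kx; elim: n => // n IHn.
by apply: sub_gen_smallest; exists x => //; exists (x ^+ n); rewrite ?exprS.
Qed.

Lemma ideal_exp_scaled K s x n :
  (forall y, K y -> exists z, s * y = z * x) ->
  forall u, ideal_exp K n u -> exists z, s ^+ n * u = x ^+ n * z.
Proof.
move=> genx; elim: n => [u _|n IHn u]; first by exists u.
move=> Ku.
suff [z] : exists2 z, [set: A] z & s ^+ n.+1 * u = x ^+ n.+1 * z by exists z.
move: u Ku; apply: smallest_sub; first exact: scaled_is_ideal.
move=> _ [y Ky [v Kv <-]].
have [z sy] := genx _ Ky; have [w sv] := IHn _ Kv.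
exists (z * w) => //; rewrite !exprS mulrACA sy sv; ring.
Qed.

Lemma ideal_mul_exp_scaled I K s x n : is_ideal I ->
  (forall y, K y -> exists z, s * y = z * x) ->
  forall u, ideal_mul (ideal_exp K n) I u ->
    exists2 z, I z & s ^+ n * u = x ^+ n * z.
Proof.
move=> idI genx; apply: smallest_sub; first exact: scaled_is_ideal.
move=> _ [v Kv [w Iw <-]]; have [z sv] := ideal_exp_scaled genx Kv.
exists (z * w); first by case: idI => _ _; apply.
by rewrite (mulrA (s ^+ n)) sv -mulrA.
Qed.

Definition maximal_ideal M : Prop :=
  [/\ is_ideal M, ~ M 1 & forall x, ~ M x -> exists r, M (1 - r * x)].

Lemma maximal_idealM M x y : maximal_ideal M -> M (x * y) -> M x \/ M y.
Proof.
move=> [[_ MD MM] _ maxM] Mxy; have [|/maxM[r Mr]] := pselect (M x); [by left|right].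
have -> : y = y * (1 - r * x) + r * (x * y) by ring.
by apply: MD; apply: MM.
Qed.

Lemma maximal_ideal_prod (T : finType) (P : pred T) (F : T -> A) M :
  maximal_ideal M -> (forall i, P i -> ~ M (F i)) -> ~ M (\prod_(i | P i) F i).
Proof.
move=> mM MF; elim/big_ind : _ => //; first by case: mM.
by move=> x y Mx My /(maximal_idealM mM)[].
Qed.

Lemma maximal_idealX M x n : maximal_ideal M -> ~ M x -> ~ M (x ^+ n).
Proof.
by move=> mM Mx; rewrite -(card_ord n) -prodr_const; apply: maximal_ideal_prod.
Qed.

Lemma exists_maximal_ideal I : is_ideal I -> ~ I 1 ->
  exists2 M, maximal_ideal M & I `<=` M.
Proof.
move=> idI I1; pose P X := is_ideal (I `|` X) /\ ~ (I `|` X) 1.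
have [F FP Ftot|X [[idX X1] maxX]] := @Zorn_bigcup _ P.
  rewrite /P.
  (* [I `|` X] for [X] in the chain, with [I] itself covering the empty chain *)
  pose G := [set X | X = I \/ exists2 Y, F Y & X = I `|` Y].
  have -> : I `|` \bigcup_(X in F) X = \bigcup_(X in G) X.
    apply/seteqP; split=> [x [Ix|[Y FY Yx]]|x [_ [->|[Y FY ->]]]].
    - by exists I => //; left.
    - by exists (I `|` Y); [right; exists Y|right].
    - by left.
    - by case; [left|right; exists Y].
  have idG X : G X -> is_ideal X /\ ~ X 1 by case=> [->//|[Y /FP PY ->]].
  have Gtot : total_on G subset.
    move=> _ _ [->|[Y FY ->]] [->|[Z FZ ->]].
    - by left.
    - by left; left.
    - by right; left.
    - by case: (Ftot _ _ FY FZ) => /(@setUS _ I); [left|right].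
  split; last by case=> X /idG[].
  split=> [|x y [X GX Xx] [Y GY Yy]|a x [X GX Xx]].
  - by exists I; [left|case: idI].
  - have [XY|YX] := Gtot _ _ GX GY.
    + by exists Y => //; have [[_ YD _] _] := idG _ GY; apply: YD => //; apply: XY.
    + by exists X => //; have [[_ XD _] _] := idG _ GX; apply: XD => //; apply: YX.
  - by exists X => //; have [[_ _ XM] _] := idG _ GX; apply: XM.
exists (I `|` X); last by left.
case: (idX) => M0 MD MM; split=> // x Mx.
(* The ideal generated by [I ∪ X] and [x]. It is strictly larger, so maximality forces it to contain
   1, which inverts [x] modulo [I ∪ X]. *)
pose B := [set y | exists r, (I `|` X) (y - r * x)].
have MB : I `|` X `<=` B by move=> y My; exists 0; rewrite mul0r subr0.
have idB : is_ideal B.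
  split=> [|y z [r Mr] [t Mt]|a y [r Mr]]; first exact: MB.
  - by exists (r + t); have := MD _ _ Mr Mt; congr (_ _); ring.
  - by exists (a * r); have := MM a _ Mr; congr (_ _); ring.
have IB : I `|` B = B by apply/setUidPr => y Iy; apply: MB; left.
have XB : X `<` B.
  split=> [y Xy|BX]; first by apply: MB; right.
  by apply: Mx; right; apply: BX; exists 1; rewrite mul1r subrr.
have [//|B1] := pselect (B 1).
by case: (maxX _ XB); rewrite /P IB.
Qed.

End IdealTheory.

(** * Local generators at finitely many maximal ideals *)

Section LocallyPrincipal.
Variable R : comNzRingType.
Implicit Types (K M N : set R).

(** The localization of [K] at [M] lies in the ideal generated by [x], with denominators cleared:
    one [s] serves all of [K]. *)
Definition generates_at M K (x : R) : Prop :=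
  exists2 s, ~ M s & forall y, K y -> exists z, s * y = z * x.

Definition locally_principal K : Prop :=
  forall M, maximal_ideal M -> exists2 x, K x & generates_at M K x.

Lemma generates_at_sub M N K x :
  maximal_ideal M -> maximal_ideal N -> N `<=` M ->
  generates_at N K x -> generates_at M K x.
Proof.
move=> [[_ MD MM] M1 _] [_ _ maxN] NM [s Ns genx]; exists s => // Ms.
have [r Nr] := maxN _ Ns; apply: M1; rewrite -(subrK (r * s) 1).
by apply: MD; [apply: NM|apply: MM].
Qed.

(** Multiply one element of each [N i] outside [M]; since [M] is prime, the product stays
    outside. *)
Lemma maximal_ideal_avoid (T : eqType) (t : seq T) (N : T -> set R) M :
  maximal_ideal M -> {in t, forall i, maximal_ideal (N i)} ->
  {in t, forall i, ~ N i `<=` M} ->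
  exists2 e, ~ M e & {in t, forall i, N i e}.
Proof.
move=> mM; elim: t => [_ _|i t IHt mN NM]; first by exists 1 => //; case: mM.
have [j tj|j tj|e Me Ne] := IHt.
- by apply: mN; rewrite in_cons tj orbT.
- by apply: NM; rewrite in_cons tj orbT.
have /existsNP[d /not_implyP[Nd Md]] : ~ N i `<=` M by apply: NM; rewrite mem_head.
exists (d * e) => [/(maximal_idealM mM)[]//|j].
have idN k : k \in i :: t -> is_ideal (N k) by move=> /mN[].
rewrite in_cons => /orP[/eqP->|tj].
- by rewrite mulrC; have [_ _] := idN _ (mem_head i t); apply.
- by have [|_ _] := idN j; [rewrite in_cons tj orbT|apply; apply: Ne].
Qed.

Lemma generates_at_seq (T : eqType) (t : seq T) (N : T -> set R) K :
  is_ideal K -> locally_principal K -> {in t, forall i, maximal_ideal (N i)} ->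
  exists2 x, K x & {in t, forall i, generates_at (N i) K x}.
Proof.
move=> idK lpK; elim: t => [_|k t IHt mN]; first by exists 0 => //; case: idK.
have mNt : {in t, forall i, maximal_ideal (N i)}.
  by move=> i ti; apply: mN; rewrite in_cons ti orbT.
have mNk : maximal_ideal (N k) by apply: mN; rewrite mem_head.
have [x Kx genx] := IHt mNt.
have [genkx|Ngenkx] := pselect (generates_at (N k) K x).
  by exists x => // i; rewrite in_cons => /orP[/eqP->//|]; apply: genx.
(* An earlier [N i] contained in [N k] would make [x] a generator at [N k] too. *)
have [e Ne te] : exists2 e, ~ N k e & {in t, forall i, N i e}.
  apply: maximal_ideal_avoid => // i ti NiNk; apply: Ngenkx.
  by apply: generates_at_sub NiNk (genx i ti) => //; apply: mNt.
have [y Ky [s Ns geny]] := lpK _ mNk.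
have [_ KD KM] := idK.
(* [x] fails to generate [K] at [N k], so [s x] is a multiple of [y] by an
   element of [N k], and adding [e y] makes that multiplier a unit there. *)
exists (x + e * y); first by apply: KD => //; apply: KM.
have [[_ ND NM] _ _] := mNk.
move=> i; rewrite in_cons => /orP[/eqP->|ti].
- have [u su] := geny _ Kx.
  have Nu : N k u.
    apply: contrapT => Nu; apply: Ngenkx; exists (u * s).
      by case/(maximal_idealM mNk).
    move=> z /geny[v sv]; exists (v * s).
    by rewrite -mulrA sv mulrCA -su mulrA.
  exists ((u + e * s) * s).
    case/(maximal_idealM mNk) => // Nues.
    have Nes : N k (e * s).
      have -> : e * s = (u + e * s) + (- 1) * u by ring.
      by apply: ND => //; apply: NM.
    by case/(maximal_idealM mNk): Nes.
  move=> z /geny[v sv]; exists (v * s).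
  rewrite -mulrA sv mulrDr mulrDl -(mulrA v s x) su; ring.
(* At an earlier [N i], [r (x + e y) = (r + e u) x], and [r + e u] stays outside [N i] because [e]
   lies in it. *)
- have [r Nr genxi] := genx _ ti; have [u ru] := genxi _ Ky.
  have mNi := mNt _ ti; have [[_ NiD NiM] _ _] := mNi.
  exists ((r + e * u) * r).
    case/(maximal_idealM mNi) => // Nreu; apply: Nr.
    have -> : r = (r + e * u) + (- u) * e by ring.
    by apply: NiD => //; apply: NiM; apply: te.
  move=> z /genxi[v rv]; exists (v * r).
  rewrite -mulrA rv; have -> : v * r * (x + e * y) = v * (r * x + e * (r * y)).
    by ring.
  by rewrite ru; ring.
Qed.

End LocallyPrincipal.

Lemma pruefer_locally_principal (R : idomainType) (s : seq R) :
  pruefer_domain R -> locally_principal (ideal_gen [set` s]).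
Proof.
move=> prR M mM; have [s0|s_neq0] := eqVneq (ideal_gen [set` s]) [set 0].
  exists 0; first by rewrite s0.
  exists 1; first by case: mM.
  by move=> y; rewrite s0 => ->; exists 0; rewrite !mulr0.
have [N [fracN _] KN] := prR s s_neq0.
set K := ideal_gen [set` s] in KN *.
have [[M0 MD MM] M1 _] := mM.
(* If some [c = a b] lies outside [M], then [a] generates [K] at [M], as [c y = (y b) a] with [y b]
   in [R]. Otherwise [K N = R] would lie in [M]. *)
have [[a [b [Ka Nb abM]]]|KNM] := pselect (exists a b,
    [/\ K a, N b & ~ [set tofrac c | c in M] (tofrac a * b)]).
  have inR y : K y -> exists z, tofrac y * b = tofrac z.
    move=> Ky; have : range (@tofrac R) (tofrac y * b).
      rewrite -KN; apply: sub_gen_smallest.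
      by exists (tofrac y); [exists y|exists b].
    by case=> z _ <-; exists z.
  have [c abc] := inR a Ka.
  exists a => //; exists c; first by move=> Mc; apply: abM; exists c.
  move=> y /inR[z yz]; exists z.
  by apply/eqP; rewrite -tofrac_eq !tofracM -abc -yz; apply/eqP; ring.
case: M1; have : fracmod_mul [set tofrac a | a in K] N 1.
  by rewrite KN; exists 1 => //; rewrite tofrac1.
move=> /(_ [set tofrac c | c in M])[|c Mc].
  split; last first.
    move=> _ [_ [a Ka <-] [b Nb <-]]; apply: contrapT => abM.
    by apply: KNM; exists a, b.
  split=> [|_ _ [x Mx <-] [y My <-]|r _ [x Mx <-]].
  - by exists 0 => //; rewrite tofrac0.
  - by exists (x + y); [apply: MD|rewrite tofracD].
  - by exists (r * x); [apply: MM|rewrite tofracM].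
by rewrite -tofrac1 => /eqP; rewrite tofrac_eq => /eqP <-.
Qed.

(** * Contents and extended ideals *)

Section ContentAlgebra.
Variables (R : comNzRingType) (B : comAlgType R).
Implicit Types (I J : set R) (f g : B).

Lemma extensionS I J : I `<=` J -> extension B I `<=` extension B J.
Proof. by move=> IJ; apply: ideal_genS => _ [r Ir <-]; exists r => //; apply: IJ. Qed.

Lemma extension_is_ideal I : is_ideal (extension B I).
Proof. exact: ideal_gen_is_ideal. Qed.

Lemma extensionZ I r f : I r -> extension B I (r *: f).
Proof.
move=> Ir; have [_ _ EM] := extension_is_ideal I.
by rewrite -mulr_algl mulrC; apply: EM; apply: sub_gen_smallest; exists r.
Qed.

Lemma content_is_ideal f : is_ideal (content f).
Proof.
split=> [J [[]]//|x y cx cy J JP|a x cx J JP].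
- by have [[_ JD _] _] := JP; apply: JD; [apply: cx|apply: cy].
- by have [[_ _ JM] _] := JP; apply: JM; apply: cx.
Qed.

Lemma content_sub I f : is_ideal I -> extension B I f -> content f `<=` I.
Proof. by move=> idI If r; apply. Qed.

(** Finitely many scalars of [content f] already witness that [f] lies in its extension; by
    minimality of the content they generate all of it. *)
Lemma content_fg f : extension B (content f) f ->
  exists s : seq R, content f = ideal_gen [set` s].
Proof.
pose E := [set g : B | exists2 s : seq R,
  [set` s] `<=` content f & extension B (ideal_gen [set` s]) g].
suff sE : extension B (content f) `<=` E.
  move=> /sE[s sf fs]; exists s; apply/seteqP; split.
    exact: content_sub (ideal_gen_is_ideal _) fs.
  by apply: smallest_sub => //; apply: content_is_ideal.
apply: smallest_sub => [|_ [r cr <-]].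
  split=> [|x y [s sf xs] [t tf yt]|a x [s sf xs]].
  - by exists [::] => //; case: (extension_is_ideal (ideal_gen [set` [::]])).
  - exists (s ++ t) => [r /=|].
      by rewrite mem_cat => /orP[/sf|/tf].
    have [_ ED _] := extension_is_ideal (ideal_gen [set` s ++ t]).
    by apply: ED; [move: x xs|move: y yt]; apply: extensionS; apply: ideal_genS;
      move=> z /=; rewrite mem_cat => ->; rewrite ?orbT.
  - exists s => //.
    by have [_ _ EM] := extension_is_ideal (ideal_gen [set` s]); apply: EM.
exists [:: r] => [z|]; first by rewrite /= inE => /eqP ->.
apply: extensionZ; apply: sub_gen_smallest.
by rewrite /= inE.
Qed.

Hypothesis hB : content_algebra B.

Lemma mem_extension_content I f : is_ideal I ->
  extension B I f <-> content f `<=` I.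
Proof.
move=> idI; split; first exact: content_sub.
by case: hB => cf _ _ _ /extensionS; apply.
Qed.

(** The content of [r%:A] is [r c(1) = r R], so [I B] contracts to [I]. *)
Lemma mem_extension_scalar I r : is_ideal I -> extension B I r%:A <-> I r.
Proof.
move=> idI; split=> [|Ir]; last exact: extensionZ.
move/mem_extension_content => /(_ idI); case: hB => _ cZ c1 _.
by rewrite cZ c1; apply; exists 1 => //; rewrite mulr1.
Qed.

Lemma extension_setT I : is_ideal I -> extension B I = setT <-> I = setT.
Proof.
move=> idI; have I1 := mem_extension_scalar 1 idI.
rewrite scale1r in I1; split=> IT.
  by apply: ideal_unit => //; apply/I1; rewrite IT.
by apply: ideal_unit (extension_is_ideal I) _; apply/I1; rewrite IT.
Qed.

End ContentAlgebra.

(** * Products of contents and absorption in the extension *)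

Section Gauss.
Variables (R : idomainType) (B : comAlgType R).
Hypothesis hB : content_algebra B.
Hypothesis lpB : forall f : B, locally_principal (content f).

Lemma content_mul (f g : B) a b :
  content f a -> content g b -> content (f * g) (a * b).
Proof.
move=> fa gb; have [C0 CD CM] := content_is_ideal (f * g).
(* Membership is local: if [Q] is proper, it lies in some maximal [M], and an element of [Q] outside
   [M] gives the contradiction. *)
pose Q := [set r | content (f * g) (r * (a * b))].
have idQ : is_ideal Q.
  split=> [|r t Qr Qt|r t Qt]; rewrite /Q /=.
  - by rewrite mul0r.
  - by rewrite mulrDl; apply: CD.
  - by rewrite -mulrA; apply: CM.
apply: contrapT => Nab; have [|M mM QM] := exists_maximal_ideal idQ.
  by rewrite /Q /= mul1r.
have [x fx [s Ms genx]] := lpB f mM; have [t sa] := genx _ fa.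
have [x0|x_neq0] := eqVneq x 0.
  by apply: Ms; apply: QM; rewrite /Q /= mulrA sa x0 mulr0 mul0r.
case: hB => _ _ _ /(_ f g)[[//|n] _ /= cfg].
have : ideal_mul (ideal_exp (content f) n.+1) (content g) (x ^+ n.+1 * b).
  apply: sub_gen_smallest; exists (x ^+ n.+1); first exact: ideal_expX.
  by exists b.
rewrite cfg => /(ideal_mul_exp_scaled (content_is_ideal _) genx)[y fgy sxb].
(* The content formula gives [s^n x^(n+1) b = x^n y] with [y] in [c(fg)]; cancel [x^n] in the
   domain. *)
have {}sxb : s ^+ n * x * b = y.
  apply: (mulfI (expf_neq0 n x_neq0)); rewrite -sxb exprS; ring.
apply: (maximal_idealX (n := n.+1) mM Ms); apply: QM; rewrite /Q /=.
have -> : s ^+ n.+1 * (a * b) = t * y.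
  by rewrite -sxb exprSr -!mulrA (mulrA s a b) sa; ring.
exact: CM.
Qed.

Lemma content_prod n (f : 'I_n -> B) (x : 'I_n -> R) :
  (forall i, content (f i) (x i)) -> content (\prod_i f i) (\prod_i x i).
Proof.
move=> fx; elim/big_rec2 : _ => [|i b a _ ba]; last exact: content_mul.
by case: hB => _ _ -> _.
Qed.

Lemma absorbing_extension n (I : set R) : is_ideal I ->
  absorbing n I -> absorbing n (extension B I).
Proof.
move=> idI [n_gt0 _ I_neqT abI]; split=> //; first exact: extension_is_ideal.
  by apply: contra_neq I_neqT => /(extension_setT hB idI).
move=> f If; apply: contrapT => /forallNP NIf.
have [E0 ED EM] := extension_is_ideal B I.
pose Q k := [set r | extension B I (r *: \prod_(i | i != k) f i)].
have idQ k : is_ideal (Q k).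
  split=> [|r t Qr Qt|r t Qt]; rewrite /Q /=.
  - by rewrite scale0r.
  - by rewrite scalerDl; apply: ED.
  - by rewrite -scalerA -mulr_algl; apply: EM.
have /choice[M MP] k : exists M, maximal_ideal M /\ Q k `<=` M.
  have [|M mM QM] := exists_maximal_ideal (idQ k); last by exists M.
  by rewrite /Q /= scale1r; apply: NIf.
have /choice[x xP] i : exists x,
    content (f i) x /\ forall k, generates_at (M k) (content (f i)) x.
  (* [x] must work at every [M k] at once: the relevant [k] is known only after the absorbing
     property of [I] is applied to these [x i]. *)
  have [|x fx genx] := generates_at_seq (t := enum 'I_n.+1)
    (content_is_ideal (f i)) (lpB (f i)) (N := M).
    by move=> k _; case: (MP k).
  by exists x; split=> // k; apply: genx; rewrite mem_enum.
have [k Ixk] : exists k, I (\prod_(i | i != k) x i).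
  apply: abI; apply: (content_sub idI If); apply: content_prod => i.
  by case: (xP i).
have /choice[s sP] i : exists s, ~ M k s /\ exists h, s *: f i = x i *: h.
  have [_ /(_ k)[s Ms genx]] := xP i; exists s; split=> //.
  have : extension B (content (f i)) (f i) by case: hB.
  (* These [g] form an ideal of [B] containing the generators of [c(f_i) B], hence [f i]. *)
  move=> /(_ [set g | exists2 h, [set: B] h & s%:A * g = (x i)%:A * h])[|h _].
    split; first exact: scaled_is_ideal.
    move=> _ [y /genx[z syz] <-]; exists z%:A => //.
    by rewrite -!(rmorphM (in_alg B)) /= syz mulrC.
  by rewrite !mulr_algl => sfi; exists h.
have /choice[h shP] i : exists h, s i *: f i = x i *: h by case: (sP i).
have [mMk QMk] := MP k.
(* The product of the [s i], [i != k], avoids [M k], yet it lies in [Q k]: it turns the product of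
   the [f i] into that of the [x i], which is in [I], times that of the [h i]. *)
apply: (maximal_ideal_prod (P := fun i => i != k) (F := s) mMk).
  by move=> i _; case: (sP i).
apply: QMk; rewrite /Q /= -scaler_prod (eq_bigr (fun i => x i *: h i)) //.
by rewrite scaler_prod; apply: extensionZ.
Qed.

End Gauss.

Lemma omega_eq (A A' : comNzRingType) (I : set A) (J : set A') :
  (I = setT <-> J = setT) -> (forall n, absorbing n I <-> absorbing n J) ->
  omega I = omega J.
Proof.
move=> IJ abIJ; rewrite /omega (asbool_equiv_eq IJ); case: ifP => // _.
have eqab : (fun n => `[< absorbing n I >]) =1 (fun n => `[< absorbing n J >]).
  by move=> n; apply: asbool_equiv_eq.
case: pselect => [exI|nexI]; case: pselect => [exJ|nexJ] //.
- by congr Some; apply: eq_ex_minn.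
- by case: nexJ; have [n] := exI; rewrite eqab; exists n.
- by case: nexI; have [n] := exJ; rewrite -eqab; exists n.
Qed.

Theorem theorem10 (R : idomainType) (hR : pruefer_domain R)
    (I : set R) (hI : is_ideal I)
    (B : comAlgType R) (hB : content_algebra B) :
  omega (extension B I) = omega I.
Proof.
have lpB (f : B) : locally_principal (content f).
  have [|s ->] := @content_fg _ B f; first by case: hB.
  exact: pruefer_locally_principal.
apply: omega_eq => [|n]; first exact: extension_setT.
split; last exact: absorbing_extension.
move=> [n_gt0 _ EI_neqT abEI]; split=> //.
  by apply: contra_neq EI_neqT => /(extension_setT hB hI).
(* Conversely, absorption descends along the structure map because [I B] contracts to [I]. *)
move=> x Ix; have [|k] := abEI (fun i => (x i)%:A).
  by rewrite -(rmorph_prod (in_alg B)); apply/mem_extension_scalar.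
by rewrite -(rmorph_prod (in_alg B)) => /mem_extension_scalar; exists k; auto.
Qed.
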